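(* Let $n$ be the number of vertices, $\rho>0$, and let $\mathcal A_{sub\text{-}VC}$ be the randomized algorithm described in the context. Then the coupled global sensitivity of $\mathcal A_{sub\text{-}VC}$ with respect to node-neighboring graphs satisfies $CGS^v_{\mathcal A_{sub\text{-}VC}}\le\frac{n\rho^2}{192\ln n}$.
   Context: Graphs are simple and undirected on a common vertex set $V$, $|V|=n$. Node-neighboring graphs $G_1,G_2$: there is a vertex $v$ such that the edge sets induced on $V\setminus\{v\}$ coincide. Greedy maximal matching w.r.t. a ranking $\pi$ (bijection from unordered pairs of distinct vertices to $\{1,\dots,\binom n2\}$): process pairs in increasing order of $\pi$, adding a pair if it is an edge and both endpoints are unmatched. Algorithm $\mathcal A_{sub\text{-}VC}$ on input $G$: choose $\pi$ uniformly at random; sample $s=16\cdot24(\ln n)/\rho^2$ vertices $v_1,\dots,v_s$ uniformly without replacement; $X_i=1$ if $v_i$ is matched in the greedy maximal matching of $G$ w.r.t. $\pi$, else $0$; output $\frac{n}{s}\sum_{i=1}^sX_i+\frac{\rho n}{4}$. A coupling of random variables $Z,Z'$ is a joint variable with marginals $Z$ and $Z'$; $\mathsf{Couple}(Z,Z')$ is the set of couplings. $CGS^v_{\mathcal A}:=\max_{G_1\sim G_2}\min_{C\in\mathsf{Couple}(\mathcal A(G_1),\mathcal A(G_2))}\max_{(z,z')\in C}|z-z'|$, outer maximum over node-neighboring pairs. *)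

(* Defs.v *)
From HB Require Import structures.
From mathcomp Require Import all_boot all_order all_algebra finmap.
From mathcomp Require Import all_classical all_reals all_analysis.

Set Implicit Arguments.
Unset Strict Implicit.
Unset Printing Implicit Defensive.

Import Order.TTheory GRing.Theory Num.Theory.

Local Open Scope classical_set_scope.
Local Open Scope ring_scope.

Section Graphs.
Variable V : finType.

Definition upair := {e : {set V} | #|e| == 2%N}.

(* A simple undirected graph with vertex set V, given by its edge set. *)
Definition graph := {set upair}.

Definition induced_edges (G : graph) (S : {set V}) : graph :=
  [set e in G | val e \subset S]%SET.

Definition node_neighbors (G1 G2 : graph) : Prop :=
  exists v : V,
    induced_edges G1 [set~ v]%SET = induced_edges G2 [set~ v]%SET.

(* Ranks start at 0 instead of 1; only their order is used. *)
Definition ranking_pred (rk : {ffun upair -> 'I_('C(#|V|, 2))}) : bool :=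
  injectiveb rk && [forall k, exists e, rk e == k].
Definition ranking := {rk | ranking_pred rk}.

Definition matched (M : {set upair}) (v : V) : bool :=
  [exists e in M, v \in val e].

Definition greedy_step (G : graph) (M : {set upair}) (e : upair) :=
  if (e \in G) && [forall v in val e, ~~ matched M v] then (e |: M)%SET else M.

Definition greedy_matching (rk : ranking) (G : graph) : {set upair} :=
  foldl (greedy_step G) finset.set0
    (sort (fun e f : upair => (val rk e <= val rk f)%N) (enum {: upair})).

Definition sample (s : nat) := {v : s.-tuple V | uniq v}.

End Graphs.

Section CoupledSensitivity.
Variable R : realType.

(* Probability mass function of f w when w is uniform on Omega. *)
Definition uniform_law (Omega : finType) (T : eqType) (f : Omega -> T) (x : T)
    : R :=
  #|[set w | f w == x]%SET|%:R / #|Omega|%:R.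

(* Couplings of two finitely supported laws P and Q on R. Every coupling of
   such laws is supported on the product of their supports, so nothing is lost
   by taking C of finite support. *)
Definition couple (P Q : R -> R) : set {fsfun R * R -> R with 0} :=
  [set C : {fsfun R * R -> R with 0} |
    [/\ forall p, 0 <= C p,
        \sum_(p <- finsupp C) C p = 1,
        forall x, \sum_(p <- finsupp C | p.1 == x) C p = P x
      & forall y, \sum_(p <- finsupp C | p.2 == y) C p = Q y]].

Definition coupling_dist (C : {fsfun R * R -> R with 0}) : \bar R :=
  ereal_sup [set (`|p.1 - p.2|)%:E | p in [set p : R * R | 0 < C p]].

(* The algorithm A is given by the law of its output on each graph. The
   infimum over couplings is a minimum: for laws of finite support,
   coupling_dist takes only finitely many values on couple P Q. *)
Definition cgs_node (V : finType) (A : graph V -> R -> R) : \bar R :=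
  ereal_sup
    [set ereal_inf [set coupling_dist C | C in couple (A G.1) (A G.2)]
       | G in [set G : graph V * graph V | node_neighbors G.1 G.2]].

End CoupledSensitivity.

Section SubVC.
Variables (R : realType) (V : finType) (rho : R).

(* The sample size 16 * 24 * ln n / rho^2, rounded up to an integer. *)
Definition sample_size (n : nat) : nat :=
  `|Num.ceil (16 * 24 * ln (n%:R : R) / rho ^+ 2)|%N.

Let n := #|V|.
Let s := sample_size n.

Definition sub_vc_output (G : graph V) (w : ranking V * sample V s) : R :=
  n%:R / s%:R *
    (\sum_(i < s) (matched (greedy_matching w.1 G) (tnth (val w.2) i))%:R)
  + rho * n%:R / 4.

Definition sub_vc (G : graph V) : R -> R := uniform_law R (sub_vc_output G).

End SubVC.

(* Main.v *)
(** Run both graphs with the same ranking and the same sample. For a fixed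
    ranking, deleting all edges at a vertex v changes the set of greedily
    matched vertices at most at v and at one further vertex, the other end of
    an alternating path starting at v. Comparing two node-neighboring graphs
    with their common subgraph avoiding v, their matched sets differ in at most
    two vertices: if v is matched in both, its contributions cancel. Hence the
    two sums differ by at most 2 and the outputs by at most 2 n / s. *)
Require Import Defs.
From mathcomp Require Import all_boot all_order all_algebra finmap.
From mathcomp Require Import all_classical all_reals all_analysis.
From mathcomp Require Import ring.

Set Implicit Arguments.
Unset Strict Implicit.
Unset Printing Implicit Defensive.

Import Order.TTheory GRing.Theory Num.Theory.

Local Open Scope ring_scope.

(** * Greedy matchings after deleting the edges at one vertex *)

Section GreedyMatching.
Variable V : finType.
Implicit Types (G : graph V) (M : {set upair V}) (e : upair V) (u v x y : V).

Lemma upair_memP e x :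
  x \in val e -> exists2 y, y != x & val e = [set x; y]%SET.
Proof.
have /cards2P [a [b [ab ->]]] := valP e.
rewrite !inE => /orP [] /eqP ->; first by exists b; rewrite // eq_sym.
by exists a => //; rewrite finset.setUC.
Qed.

Definition free M e : bool := [forall v in val e, ~~ matched M v].

Lemma free_pair M e x y :
  val e = [set x; y]%SET -> free M e = ~~ matched M x && ~~ matched M y.
Proof.
move=> exy; apply/forall_inP/andP => [Mfree|[Mx My] z].
  by split; apply: Mfree; rewrite exy !inE eqxx ?orbT.
by rewrite exy !inE => /orP [] /eqP ->.
Qed.

Lemma matched_greedy_step G M e u :
  matched (greedy_step G M e) u =
  matched M u || [&& e \in G, free M e & u \in val e].
Proof.
rewrite /greedy_step -/(free M e); case: (e \in G); last by rewrite orbF.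
case: (free M e); last by rewrite orbF.
apply/exists_inP/orP => [[f]|[/exists_inP [f fM uf]|ue]].
- rewrite !inE => /orP [/eqP -> ->|fM uf]; [by right|left].
  by apply/exists_inP; exists f.
- by exists f; rewrite // !inE fM orbT.
- by exists e; rewrite // !inE eqxx.
Qed.

(* Matched vertices of a greedy run on a graph (M) and on the same graph
   without the edges at v (M0): they differ at the two ends of an alternating
   path starting at v, which is empty as long as v is unmatched. *)
Definition alternating v M M0 : Prop :=
  ~~ matched M0 v /\
  ((forall u, matched M u = matched M0 u) \/
   matched M v /\ exists2 x, x != v &
     forall u, matched M u (+) matched M0 u = (u == v) || (u == x)).

(** Only an edge touching an end of the path can be treated differently by the two runs: at [v] it
    can start the path, at the far end [x] it can extend the path by one edge. *)
Lemma alternating_step G v M M0 e :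
  alternating v M M0 ->
  alternating v (greedy_step G M e)
    (greedy_step (induced_edges G [set~ v]%SET) M0 e).
Proof.
case=> M0v altM; rewrite /alternating.
set G0 := induced_edges G _.
have eG0 : (e \in G0) = (e \in G) && (v \notin val e).
  by rewrite inE -finset.setTD finset.subsetD1 finset.subsetT.
split.
  rewrite matched_greedy_step negb_or M0v eG0.
  by case: (v \in _); rewrite !(andbF, andbT).
have stepE u := (matched_greedy_step G M e u, matched_greedy_step G0 M0 e u).
case: altM => [eqM|[Mv [x xv altM]]].
- have eqfree : free M e = free M0 e by apply: eq_forallb => w; rewrite eqM.
  have [ve|ve] := boolP (v \in val e); last first.
    by left=> u; rewrite !stepE eG0 ve andbT eqM eqfree.
  have [/andP [eG fe]|nGf] := boolP ((e \in G) && free M e); last first.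
    left=> u; rewrite !stepE eG0 ve andbF orbF andbA (negbTE nGf) orbF.
    exact: eqM.
  (* The path starts here: only the full run takes [e], so the other endpoint of [e] becomes the far
     end. *)
  right; split; first by rewrite stepE eG fe ve orbT.
  have [x xv exv] := upair_memP ve; exists x => // u.
  rewrite !stepE eG0 ve eG fe /= orbF exv !inE eqM.
  have := fe; rewrite (free_pair _ exv) !eqM => /andP [/negbTE m0v /negbTE m0x].
  have [->|uv] := eqVneq u v; first by rewrite m0v.
  have [->|ux] := eqVneq u x; first by rewrite m0x.
  by case: (matched M0 u).
- have agree u : u != v -> u != x -> matched M u = matched M0 u.
    move=> /negbTE uv /negbTE ux; have := altM u; rewrite uv ux.
    by case: (matched M u); case: (matched M0 u).
  right; split; first by rewrite stepE Mv.
  have [ve|ve] := boolP (v \in val e).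
    exists x => // u; rewrite !stepE eG0 ve andbF orbF.
    (* Neither run takes [e]: its endpoint [v] is already matched in [M], and [e] is absent from
       [G0]. *)
    suff -> : free M e = false by rewrite andbF orbF.
    by apply/negbTE/negP => /forall_inP /(_ v ve); rewrite Mv.
  have neqv w : w \in val e -> w != v by apply: contraTneq => ->.
  have [xe|xe] := boolP (x \in val e); last first.
    have neqx w : w \in val e -> w != x by apply: contraTneq => ->.
    have eqfree : free M e = free M0 e.
      apply: eq_forallb => w; case we: (w \in val e) => //=.
      by rewrite agree ?neqv ?neqx.
    exists x => // u; rewrite !stepE eG0 ve andbT eqfree -altM.
    have [ue|] := boolP (u \in val e); last by rewrite !andbF !orbF.
    by rewrite agree ?neqv ?neqx // !addbb.
  have [y yx exy] := upair_memP xe.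
  have yv : y != v by apply: neqv; rewrite exy !inE eqxx orbT.
  (* Exactly one run has [x] matched. If [y] is unmatched, the other run takes [e], after which the
     runs agree at [x] and differ at [y]: the far end moves to [y]. *)
  have [/andP [eG My]|nGy] := boolP ((e \in G) && ~~ matched M y).
    exists y => // u; rewrite !stepE eG0 ve eG !(free_pair _ exy) exy !inE.
    have M0y : ~~ matched M0 y by rewrite -agree.
    have := altM u; have := altM x; rewrite eqxx orbT My M0y !andbT /=.
    have [->|ux] := eqVneq u x.
      rewrite (negbTE xv) eq_sym (negbTE yx) /=.
      by case: (matched M x); case: (matched M0 x).
    have [->|uy] := eqVneq u y.
      rewrite (negbTE yv) (negbTE My) (negbTE M0y) /=.
      by case: (matched M x); case: (matched M0 x).
    by rewrite !andbF !orbF.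
  (* Now [e] is no edge of [G] or [y] is matched in both runs, so neither takes [e]. *)
  exists x => // u; rewrite !stepE eG0 ve andbT !(free_pair _ exy).
  rewrite -(agree y) // -altM.
  move: nGy; case: (e \in G) => /=; last by rewrite !orbF.
  by move=> /negbTE ->; rewrite !andbF !orbF.
Qed.

Lemma alternating_greedy (s : seq (upair V)) G v :
  alternating v (foldl (greedy_step G) finset.set0 s)
    (foldl (greedy_step (induced_edges G [set~ v]%SET)) finset.set0 s).
Proof.
suff alt_foldl M M0 : alternating v M M0 ->
    alternating v (foldl (greedy_step G) M s)
      (foldl (greedy_step (induced_edges G [set~ v]%SET)) M0 s).
  by apply: alt_foldl; split; [apply/exists_inP => -[e]; rewrite inE|left].
elim: s M M0 => //= e s IHs M M0 altM.
by apply: IHs; apply: alternating_step.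
Qed.

Lemma alternating_diff v M1 M2 M0 :
  alternating v M1 M0 -> alternating v M2 M0 ->
  exists x y, forall u,
    matched M1 u != matched M2 u -> (u == x) || (u == y).
Proof.
move=> [_ alt1] [_ alt2].
case: alt1 => [eq1|[_ [x _ alt1]]]; case: alt2 => [eq2|[_ [y _ alt2]]].
- by exists v, v => u; rewrite eq1 eq2 eqxx.
- by exists v, y => u; rewrite eq1 -alt2 addbC negb_eqb.
- by exists v, x => u; rewrite eq2 -alt1 negb_eqb.
- exists x, y => u; rewrite negb_eqb.
  have := alt1 u; have := alt2 u.
  case: (u == x); case: (u == y) => //; case: (u == v);
  by case: (matched M1 u); case: (matched M2 u); case: (matched M0 u).
Qed.

Lemma greedy_matching_neighbors (rk : ranking V) (G1 G2 : graph V) :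
  node_neighbors G1 G2 -> exists x y, forall u,
    matched (greedy_matching rk G1) u != matched (greedy_matching rk G2) u ->
    (u == x) || (u == y).
Proof.
move=> [v eqG]; apply: (alternating_diff (alternating_greedy _ G1 v)).
by rewrite eqG; apply: alternating_greedy.
Qed.

(** * Nonemptiness of the space of rankings and samples *)

Lemma card_upair : #|{: upair V}| = 'C(#|V|, 2).
Proof. by rewrite card_sig -card_draws cardsE. Qed.

Lemma card_ranking_gt0 : (0 < #|{: ranking V}|)%N.
Proof.
pose rk : {ffun upair V -> 'I_('C(#|V|, 2))} :=
  [ffun e => cast_ord card_upair (enum_rank e)].
suff rkP : ranking_pred rk by apply/card_gt0P; exists (exist _ rk rkP).
apply/andP; split.
  by apply/injectiveP => e f; rewrite !ffunE => /cast_ord_inj /enum_rank_inj.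
apply/forallP => k; apply/existsP.
exists (enum_val (cast_ord (esym card_upair) k)).
by rewrite ffunE enum_valK cast_ordKV.
Qed.

Lemma card_sample_gt0 (s : nat) : (s <= #|V|)%N -> (0 < #|{: sample V s}|)%N.
Proof.
move=> sV.
have size_s : size (take s (enum V)) == s by rewrite size_takel -?cardE.
have uniq_s : uniq (Tuple size_s) by rewrite take_uniq ?enum_uniq.
by apply/card_gt0P; exists (exist _ (Tuple size_s) uniq_s).
Qed.

End GreedyMatching.

(** * Coupling by shared randomness *)

Section UniformCoupling.
Variables (R : realType) (Omega : finType) (f1 f2 : Omega -> R).
Hypothesis Omega_gt0 : (0 < #|Omega|)%N.

Let f w := (f1 w, f2 w).

Definition joint_support : {fset R * R} := seq_fset tt [seq f w | w : Omega].

(** The joint law of [f1 w] and [f2 w] for a single uniform [w]. *)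
Definition uniform_coupling : {fsfun R * R -> R with 0} :=
  [fsfun p in joint_support => uniform_law R f p].

Lemma uniform_couplingE p : uniform_coupling p = uniform_law R f p.
Proof.
rewrite fsfunE; case: ifPn => //; rewrite seq_fsetE => fp.
rewrite /uniform_law (_ : [set w | _]%SET = finset.set0).
  by rewrite finset.cards0 mul0r.
apply/finset.setP => w; rewrite !inE; apply: contraNF fp => /eqP <-.
by apply: map_f; rewrite mem_enum.
Qed.

(** Double counting: each [w] contributes mass [1 / #|Omega|] at the single point [f w]. Suitable
    choices of [P] give the total mass and both marginals. *)
Lemma sum_uniform_coupling (P : pred (R * R)) :
  \sum_(p <- finsupp uniform_coupling | P p) uniform_coupling p =
  #|[set w | P (f w)]%SET|%:R / #|Omega|%:R.
Proof.
transitivity (\sum_(p <- finsupp uniform_coupling | P p)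
                \sum_(w : Omega | f w == p) (#|Omega|%:R^-1 : R)).
  apply: eq_bigr => p _; rewrite uniform_couplingE /uniform_law sumr_const.
  by rewrite cardsE mulr_natl.
rewrite (exchange_big_dep (fun w => P (f w))) /=; last first.
  by move=> p w Pp /eqP ->.
rewrite cardsE mulr_natl -[RHS]sumr_const; apply: eq_bigr => w Pw.
rewrite (eq_bigl (fun p => p == f w)); last first.
  by move=> p; rewrite eq_sym; case: eqP => [->|]; rewrite ?Pw ?andbF.
rewrite -big_filter filter_pred1_uniq ?fset_uniq ?big_seq1 //.
rewrite mem_finsupp uniform_couplingE.
rewrite mulf_neq0 ?invr_eq0 ?pnatr_eq0 -?lt0n //.
by apply/card_gt0P; exists w; rewrite inE.
Qed.

Lemma uniform_coupling_couple :
  couple (uniform_law R f1) (uniform_law R f2) uniform_coupling.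
Proof.
split=> [p||x|y]; rewrite ?sum_uniform_coupling //.
  by rewrite uniform_couplingE divr_ge0 ?ler0n.
rewrite (_ : [set w | _]%SET = finset.setT) ?finset.cardsT; last first.
  by apply/finset.setP => w; rewrite !inE.
by rewrite divff // pnatr_eq0 -lt0n.
Qed.

Lemma coupling_dist_uniform (c : R) :
  (forall w, `|f1 w - f2 w| <= c) -> (coupling_dist uniform_coupling <= c%:E)%E.
Proof.
move=> dist_le; apply: ge_ereal_sup => _ [p /= Cp <-]; rewrite lee_fin.
move: Cp; rewrite uniform_couplingE => Cp.
suff [w /eqP <-] : exists w, f w == p by apply: dist_le.
apply/existsP; apply: contraTT Cp => /existsPn fp; rewrite -leNgt.
rewrite /uniform_law (_ : [set w | _]%SET = finset.set0).
  by rewrite finset.cards0 mul0r.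
by apply/finset.setP => w; rewrite !inE (negbTE (fp w)).
Qed.

Lemma coupling_dist_inf (c : R) :
  (forall w, `|f1 w - f2 w| <= c) ->
  (ereal_inf [set coupling_dist C | C in
     couple (uniform_law R f1) (uniform_law R f2)]%classic <= c%:E)%E.
Proof.
move=> /coupling_dist_uniform; apply: le_trans; apply: ereal_inf_lbound.
by exists uniform_coupling => //; apply: uniform_coupling_couple.
Qed.

End UniformCoupling.

(** * Bounds on the sampled sums and on the scaling factor *)

(** Sampling without replacement enters here: each of the two exceptional vertices is drawn at most
    once. *)
Lemma count_mem2_le (T : eqType) (t : seq T) (P : pred T) (x y : T) :
  uniq t -> (forall u, P u -> (u == x) || (u == y)) -> (count P t <= 2)%N.
Proof.
move=> t_uniq Pxy; rewrite -size_filter.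
apply: (@uniq_leq_size _ _ [:: x; y]); first exact: filter_uniq.
by move=> u; rewrite mem_filter !inE => /andP [/Pxy].
Qed.

Lemma norm_sub_sum_bool_le (R : realType) (s : nat) (V : eqType)
    (t : s.-tuple V) (p q : pred V) :
  `|\sum_(i < s) (p (tnth t i))%:R - \sum_(i < s) (q (tnth t i))%:R| <=
  (count (fun u => p u != q u) t)%:R :> R.
Proof.
rewrite -sum1_count big_tuple natr_sum -sumrB [leRHS]big_mkcond /=.
apply: le_trans (ler_norm_sum _ _ _) _; apply: ler_sum => i _.
case: (p _); case: (q _); rewrite /= ?subrr ?subr0 ?sub0r ?normrN;
  by rewrite ?normr0 ?normr1.
Qed.

Lemma sample_size_ge (R : realType) (rho : R) (n : nat) :
  16 * 24 * ln (n%:R : R) / rho ^+ 2 <= (sample_size rho n)%:R.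
Proof.
rewrite /sample_size natr_absz intr_norm.
exact: le_trans (ceil_ge _) (ler_norm _).
Qed.

Lemma double_scale_le (R : realType) (rho : R) (n : nat) :
  0 < rho ->
  n%:R / (sample_size rho n)%:R * 2 <=
  n%:R * rho ^+ 2 / (192 * ln (n%:R : R)).
Proof.
(* For [n <= 1] the logarithm is 0, with [ln 0 = 0] by convention, and so is the sample size;
   division by 0 yields 0 on both sides. *)
move=> rho_gt0; case: (ltnP 1 n) => [n_gt1|]; last first.
  have ln_n0 : (n <= 1)%N -> ln (n%:R : R) = 0.
    by case: n => [|[|//]] _; rewrite ?ln1 ?ln0.
  move=> /ln_n0 ln_n; rewrite /sample_size ln_n !mulr0 mul0r ceil0.
  by rewrite invr0 !mulr0 mul0r.
have ln_gt : 0 < ln (n%:R : R) by rewrite ln_gt0 // ltr1n.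
have := sample_size_ge rho n; set s : R := _%:R; set L := ln _ in ln_gt *.
have r2 : 0 < rho ^+ 2 by rewrite exprn_gt0.
have a_gt0 : 0 < 16 * 24 * L / rho ^+ 2 by rewrite divr_gt0 ?mulr_gt0.
move=> s_ge; have s_gt0 := lt_le_trans a_gt0 s_ge.
(* The constant 192 is [16 * 24 / 2], the 2 being the number of differing vertices. *)
have -> : n%:R * rho ^+ 2 / (192 * L) =
    n%:R / (16 * 24 * L / rho ^+ 2) * 2.
  by field; rewrite !gt_eqF.
by rewrite ler_pM2r // ler_wpM2l // lef_pV2 ?posrE.
Qed.

Theorem theorem9 (R : realType) (V : finType) (n : nat) (rho : R)
    (card_V : #|V| = n) (rho_gt0 : 0 < rho)
    (size_le : (sample_size rho n <= n)%N) :
  (cgs_node (@sub_vc R V rho) <=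
     (n%:R * rho ^+ 2 / (192 * ln (n%:R : R)))%:E)%E.
Proof.
subst n; apply: ge_ereal_sup => _ [[G1 G2] /= neighG <-].
apply: coupling_dist_inf => [|[rk t]].
  (* [size_le] ensures that a sample without repetition exists. *)
  by rewrite card_prod muln_gt0 card_ranking_gt0 card_sample_gt0.
apply: le_trans (double_scale_le _ rho_gt0).
(* The additive shift [rho * n / 4] cancels, leaving the factor [n / s] times the difference of the
   two sums. *)
rewrite /sub_vc_output opprD addrACA subrr addr0 -mulrBr normrM.
rewrite ger0_norm ?divr_ge0 // ler_wpM2l ?divr_ge0 //.
apply: le_trans (norm_sub_sum_bool_le _ _ _ _) _; rewrite ler_nat.
have [x [y diffG]] := greedy_matching_neighbors rk neighG.
exact: count_mem2_le (valP t) diffG.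
Qed.
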